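(* Let $I$ be a set, let $R,S\subseteq I\times I$, $M_R=[a_{ij}]$ and $M_S=[b_{ij}]$, and put \[ A_i:=\{j\in I\mid a_{ij}=1\},\qquad B_k:=\{i\in I\mid b_{ik}=0\},\qquad C_k:=\bigcup_{l\in B_k}A_l \] for all $i,k\in I$. (i) The equation $R\circ X=S$ is solvable (i.e. has a solution $X\subseteq I\times I$) if and only if $A_i\setminus C_k\neq\emptyset$ for all $k\in I$ and all $i\in I\setminus B_k$. (ii) A relation $X\subseteq I\times I$ with $M_X=[x_{ij}]$ is a solution of the equation $R\circ X=S$ if and only if the following two conditions hold: (a) $x_{jk}=0$ for all $k\in I$ and all $j\in C_k$; (b) for every $k\in I$ and every $i\in I\setminus B_k$ there exists some $j\in A_i\setminus C_k$ with $x_{jk}=1$.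
   Context: For a relation $R\subseteq I\times I$, its incidence matrix $M_R=[a_{ij}]$ is the mapping $I\times I\to\{0,1\}$ with $a_{ij}=1$ if $(i,j)\in R$ and $a_{ij}=0$ otherwise. Composition of relations is $R\circ X=\{(x,y)\in I\times I\mid \text{there exists } z\in I \text{ with } (x,z)\in R \text{ and } (z,y)\in X\}$. *)

(* Defs.v *)
From mathcomp Require Import all_boot boolp classical_sets.

Set Implicit Arguments.
Unset Strict Implicit.
Unset Printing Implicit Defensive.

Local Open Scope classical_set_scope.

(* The entry set {0, 1} is bool, with 1 read as true and 0 as false. *)
Definition incidence (I : Type) (R : set (I * I)) : I -> I -> bool :=
  fun i j => (i, j) \in R.

(* The library's (B \; A) relates x to y when A (x, z) and B (z, y) for some z,
   so its factors come in the opposite order to those of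
   R o X = {(x, y) | exists z, (x, z) \in R and (z, y) \in X}. *)
Definition rcomp (I : Type) (R X : set (I * I)) : set (I * I) :=
  (X \; R)%relation.

Lemma rcompE (I : Type) (R X : set (I * I)) (x y : I) :
  rcomp R X (x, y) <-> exists z, R (x, z) /\ X (z, y).
Proof. by split=> [[z Rxz Xzy]|[z [Rxz Xzy]]]; exists z. Qed.

Lemma incidenceP (I : Type) (R : set (I * I)) (i j : I) :
  reflect (R (i, j)) (incidence R i j).
Proof. by rewrite /incidence; apply: (iffP idP) => [/set_mem|/mem_set]. Qed.

(* Main.v *)
Require Import Defs.
From mathcomp Require Import all_boot boolp classical_sets.

Local Open Scope classical_set_scope.

(* The condition on X at the entries (j, k) with j in C_k says exactly that
   R o X is included in S; so X may use only the remaining entries, and using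
   all of them gives the largest candidate, which decides solvability. *)

(** This is $C_k$ with the matrices replaced by membership; the [exists2] has the shape to which the
    indexed union unfolds. *)
Definition excluded (I : Type) (R S : set (I * I)) (k : I) : set I :=
  [set j | exists2 l, ~ S (l, k) & R (l, j)].

Lemma rcomp_subset (I : Type) (R S X : set (I * I)) :
  rcomp R X `<=` S <-> forall k j, excluded I R S k j -> ~ X (j, k).
Proof.
split=> [sub k j [l nSlk Rlj] Xjk|avoid [i k] [j Rij Xjk]].
  by apply/nSlk/sub/rcompE; exists j.
by apply: contrapT => nSik; apply: (avoid k j) => //; exists i.
Qed.

(** Each clause accounts for one inclusion. Under the first, any intermediate point through [X] is
    automatically not excluded; recording this in the second leaves a condition on [R] and [S] alone
    once [X] is dropped. *)
Lemma rcomp_eq (I : Type) (R S X : set (I * I)) :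
  rcomp R X = S <->
    (forall k j, excluded I R S k j -> ~ X (j, k)) /\
    (forall k i, S (i, k) ->
       exists2 j, R (i, j) /\ ~ excluded I R S k j & X (j, k)).
Proof.
split=> [RXS|[avoid hit]].
  have avoid : forall k j, excluded I R S k j -> ~ X (j, k).
    by apply/rcomp_subset; rewrite RXS.
  split=> // k i; rewrite -{1}RXS => /rcompE[j [Rij Xjk]].
  by exists j => //; split=> // /avoid.
apply/seteqP; split; first exact/rcomp_subset.
by move=> [i k] /hit[j [Rij _] Xjk]; apply/rcompE; exists j.
Qed.

Lemma rcomp_solvable (I : Type) (R S : set (I * I)) :
  (exists X, rcomp R X = S) <->
    forall k i, S (i, k) -> exists j, R (i, j) /\ ~ excluded I R S k j.
Proof.
split=> [[X /rcomp_eq[_ hit]] k i /hit[j Rj _]|ne]; first by exists j.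
(* With [p] read as [(j, k)], the first clause holds by construction and the second becomes [ne]. *)
exists [set p | ~ excluded I R S p.2 p.1]; apply/rcomp_eq.
by split=> [k j exj /(_ exj)|k i /ne[j [Rij nexj]]] //; exists j.
Qed.

Theorem theorem14 (I : Type) (R S : set (I * I)) :
  let a := incidence R in
  let b := incidence S in
  let A := fun i : I => [set j | a i j = true] in
  let B := fun k : I => [set i | b i k = false] in
  let C := fun k : I => \bigcup_(l in B k) A l in
  ((exists X : set (I * I), rcomp R X = S) <->
     (forall k i : I, (~` B k) i -> A i `\` C k !=set0))
  /\
  (forall X : set (I * I),
     let x := incidence X in
     rcomp R X = S <->
       (forall k j : I, C k j -> x j k = false)
       /\
       (forall k i : I, (~` B k) i ->
          exists2 j, (A i `\` C k) j & x j k = true)).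
Proof.
move=> a b A B C.
(* Equalities of propositions, not just equivalences, so that they can rewrite inside the sets [A],
   [B] and [C]. *)
have trueE (T : set (I * I)) i j : (incidence T i j = true) = T (i, j).
  by apply/propext; split=> /incidenceP.
have falseE (T : set (I * I)) i j : (incidence T i j = false) = ~ T (i, j).
  by rewrite -trueE; case: incidence; apply/propext; split.
have AE i : A i = [set j | R (i, j)].
  by apply/funext => j; rewrite /A /= trueE.
have BE k : B k = [set i | ~ S (i, k)].
  by apply/funext => i; rewrite /B /= falseE.
(* The complement of [B k] is a double negation of membership in [S], removed classically. *)
have BCE k i : (~` B k) i = S (i, k) by rewrite BE; exact: notK.
have CE k : C k = excluded I R S k.
  by rewrite /C BE (funext AE).
have ACE i k j : (A i `\` C k) j = (R (i, j) /\ ~ excluded I R S k j).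
  by rewrite AE CE.
split=> [|X x].
  rewrite rcomp_solvable; split=> ne k i.
    by rewrite BCE => /ne[j Rj]; exists j; rewrite ACE.
  by rewrite -BCE => /ne[j]; rewrite ACE; exists j.
rewrite rcomp_eq; split=> -[avoid hit]; split=> k i.
- by rewrite CE falseE; exact: avoid.
- by rewrite BCE => /hit[j Rj Xjk]; exists j; rewrite ?ACE ?trueE.
- by rewrite -CE -falseE; exact: avoid.
- by rewrite -BCE => /hit[j]; rewrite ACE trueE; exists j.
Qed.
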